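(* Let $\Delta$ be a positive integer with $\Delta>2$, and let $T$ be a tree with $n$ vertices whose maximum degree is at least $\Delta$. Then $$\chi(T)\ge \chi(T_{n,\Delta}),$$ with equality if and only if $T=T_{n,\Delta}$ (i.e. $T$ is isomorphic to $T_{n,\Delta}$).
   Context: All trees are finite and unweighted. A subtree of a tree $T$ is a nonempty connected subgraph of $T$ (single vertices are allowed), and $\chi(T)$ denotes the number of subtrees of $T$. $P_m$ is the path with $m$ vertices. $T_{n,\Delta}$ is the tree with $n$ vertices obtained from the path $P_{n-\Delta+1}$ by attaching $\Delta-1$ pendant edges (each with a new leaf) to one of the end vertices of $P_{n-\Delta+1}$. *)

(* Defs.v *)
From mathcomp Require Import all_boot.

Set Implicit Arguments.
Unset Strict Implicit.
Unset Printing Implicit Defensive.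

(* A finite simple graph is given by its adjacency relation on a finType. *)
Definition simple_graph (V : finType) (e : rel V) : Prop :=
  symmetric e /\ irreflexive e.

(* [ucycle e c] also holds for lists of size at most 2 (the empty list, and
   an edge traversed back and forth); these are not cycles of the graph. *)
Definition acyclic (V : finType) (e : rel V) : Prop :=
  forall c : seq V, 2 < size c -> ~ ucycle e c.

Definition is_tree (V : finType) (e : rel V) : Prop :=
  [/\ simple_graph e, 0 < #|V|, forall x y : V, connect e x y & acyclic e].

Definition degree (V : finType) (e : rel V) (v : V) : nat := #|[set w | e v w]|.

Definition max_degree (V : finType) (e : rel V) : nat := \max_(v : V) degree e v.

Definition edge_set (V : finType) (e : rel V) : {set {set V}} :=
  [set [set p.1; p.2] | p : V * V & e p.1 p.2].

(* A subgraph is a pair H = (vertex set, edge set). *)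
Definition is_subgraph (V : finType) (e : rel V) (H : {set V} * {set {set V}}) : bool :=
  (H.2 \subset edge_set e) && [forall A in H.2, A \subset H.1].

Definition connected_subgraph (V : finType) (H : {set V} * {set {set V}}) : bool :=
  [forall x in H.1, forall y in H.1,
    connect (fun u v : V => [set u; v] \in H.2) x y].

Definition is_subtree (V : finType) (e : rel V) (H : {set V} * {set {set V}}) : bool :=
  [&& is_subgraph e H, H.1 != set0 & connected_subgraph H].

Definition num_subtrees (V : finType) (e : rel V) : nat :=
  #|[set H : {set V} * {set {set V}} | is_subtree e H]|.

Definition graph_iso (V W : finType) (e : rel V) (e' : rel W) : Prop :=
  exists2 f : V -> W, bijective f & forall x y : V, e' (f x) (f y) = e x y.

(* T_{n,Delta}: the [inl] vertices form the path P_{n-Delta+1}, and the [inr]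
   vertices are the Delta-1 leaves attached to its end vertex [ord_max].  The
   truncated operations are the usual ones when 0 < Delta <= n. *)
Definition broom_vertex (n Delta : nat) : finType :=
  ('I_(n - Delta).+1 + 'I_(Delta - 1))%type.

Definition broom (n Delta : nat) : rel (broom_vertex n Delta) :=
  fun x y => match x, y with
  | inl i, inl j => (i.+1 == j :> nat) || (j.+1 == i :> nat)
  | inl i, inr _ | inr _, inl i => i == ord_max
  | inr _, inr _ => false
  end.

Arguments broom : clear implicits.

(* Main.v *)
(** In a tree, subtrees correspond to nonempty connected vertex sets.  Let [v]
    have [Delta = D + 1] chosen neighbours [N], and build the tree from the star
    [v |: N] by adding one vertex [x] at a time.  In a connected set with [k]
    vertices containing the star, the connected subsets containing [x] number at
    least [k - Delta + 2^D]: let [P] be a connected set avoiding [v] that contains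
    [x] and a neighbour of [v]; by acyclicity [P] meets [N] in at most one vertex,
    so [P] has at least [#|P|] connected subsets containing [x], adjoining [v] and
    any subset of [N :\: P] gives [2^D] others, and each vertex still missing
    brings at least one more.  Summing up gives the count of the broom.  An
    increment is strictly larger as soon as [x] is not attached to the far end
    of the handle, so equality forces a broom. *)
Require Import Defs.
From mathcomp Require Import all_boot.
From mathcomp Require Import zify.

Set Implicit Arguments.
Unset Strict Implicit.
Unset Printing Implicit Defensive.

(** * Paths across a cut, disjoint unions, and the target count *)

Lemma connect_cut (V : finType) (r : rel V) (U : {set V}) (x y : V) :
  connect r x y -> x \in U -> y \notin U ->
  exists a b, [/\ a \in U, b \notin U & r a b].
Proof.
case/connectP=> p; elim: p x => [|z p IHp] x /=.
  by move=> _ -> ->.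
case/andP=> rxz rp lastp xU yU.
have [zU|zU] := boolP (z \in U); first exact: IHp rp lastp zU yU.
by exists x, z.
Qed.

Lemma leq_card_disjointU (T : finType) (A B C : {set T}) :
  A \subset C -> B \subset C -> [disjoint A & B] -> #|A| + #|B| <= #|C|.
Proof.
move=> AC BC dAB; rewrite -cardsUI disjoint_setI0 // cards0 addn0.
by apply: subset_leq_card; rewrite subUset AC.
Qed.

(* The number of subtrees of the broom with [D] leaves at the hub and a handle
   of [m] vertices, hub included. *)
Definition broom_count (D m : nat) := m * 2 ^ D + 'C(m, 2) + D.

Lemma broom_countS (D m : nat) :
  broom_count D m.+1 = broom_count D m + (m + 2 ^ D).
Proof. by rewrite /broom_count binS bin1 mulSn; lia. Qed.

(** * Connected vertex sets and their growth *)

Section ConnectedSets.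

Variables (V : finType) (e : rel V).
Hypothesis e_sym : symmetric e.

(** Connectedness by cuts rather than by paths: a nonempty proper part of [B] always has an edge out
    of it inside [B], which is what growing a set vertex by vertex requires. *)
Definition con (B : {set V}) :=
  (B != set0) &&
  [forall U : {set V}, (U != set0) && (U \proper B) ==>
     [exists x in U, [exists y in B :\: U, e x y]]].

Lemma conP (B : {set V}) :
  reflect (B != set0 /\ forall U : {set V}, U != set0 -> U \proper B ->
             exists x y, [/\ x \in U, y \in B, y \notin U & e x y])
          (con B).
Proof.
apply: (iffP andP) => -[B0 H]; split=> //.
  move=> U U0 UB; move/forallP/(_ U): H; rewrite U0 UB /=.
  case/exists_inP=> x xU /exists_inP[y]; rewrite inE => /andP[yU yB] exy.
  by exists x, y.
apply/forallP=> U; apply/implyP=> /andP[U0 UB].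
have [x [y [xU yB yU exy]]] := H U U0 UB.
apply/exists_inP; exists x => //; apply/exists_inP; exists y => //.
by rewrite inE yU.
Qed.

Lemma con1 (x : V) : con [set x].
Proof.
apply/conP; split; first by apply/set0Pn; exists x; rewrite set11.
move=> U U0; rewrite properEneq subset1 (negPf U0) orbF.
by case/andP=> /negPf->.
Qed.

(** A part [U] of the union either contains [K] and is left towards [S], or misses [K] and is left
    from [S] into [K], or cuts [K] itself. *)
Lemma con_setU_nbrs (K S : {set V}) :
  con K -> (forall z, z \in S -> exists2 y, y \in K & e y z) -> con (K :|: S).
Proof.
case/conP=> K0 cutK nbrS; apply/conP; split.
  by case/set0Pn: K0 => x xK; apply/set0Pn; exists x; rewrite inE xK.
move=> U U0 /properP[UKS [b bKS bU]].
have [KU|KU] := boolP (K \subset U).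
  have bS : b \in S.
    by move: bKS; rewrite inE => /orP[/(subsetP KU)|//]; rewrite (negPf bU).
  have [y yK eyb] := nbrS b bS.
  by exists y, b; split=> //; apply: (subsetP KU).
have [KU0|KU0] := eqVneq (K :&: U) set0.
  case/set0Pn: U0 => z zU.
  have zK : z \notin K.
    by apply/negP=> zK; move/setP/(_ z): KU0; rewrite !inE zK zU.
  have zS : z \in S by move/(subsetP UKS): (zU); rewrite inE (negPf zK).
  have [y yK eyz] := nbrS z zS.
  exists z, y; split=> //; [by rewrite inE yK| |by rewrite e_sym].
  by apply/negP=> yU; move/setP/(_ y): KU0; rewrite !inE yK yU.
have pK : K :&: U \proper K.
  by rewrite properE subsetIl subsetI subxx.
have [x [y [xKU yK yKU exy]]] := cutK _ KU0 pK.
exists x, y; split=> //.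
- by case/setIP: xKU.
- by rewrite inE yK.
- by apply: contra yKU => yU; rewrite inE yK.
Qed.

Lemma con_setU1 (K : {set V}) (x y : V) :
  con K -> y \in K -> e y x -> con (x |: K).
Proof.
move=> cK yK eyx; rewrite setUC; apply: con_setU_nbrs => // z /set1P->.
by exists y.
Qed.

Lemma con_path (x : V) (p : seq V) : path e x p -> con [set z in x :: p].
Proof.
elim: p x => [|y p IHp] x /=.
  by move=> _; rewrite set_cons set_nil setU0 con1.
case/andP=> exy yp; rewrite set_cons.
by apply: (@con_setU1 _ x y (IHp y yp)); rewrite 1?e_sym // inE mem_head.
Qed.

(** Induction principle for building [A] from [Q]: while [B] is not yet [A], connectedness of [A]
    yields an edge from [B] to a missing [x], and [x |: B] is again connected. *)
Lemma con_grow (P : {set V} -> Prop) (Q A : {set V}) :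
  con Q -> con A -> Q \subset A -> P Q ->
  (forall (B : {set V}) (x y : V), con B -> Q \subset B -> B \subset A ->
     x \in A -> x \notin B -> y \in B -> e y x -> P B -> P (x |: B)) ->
  P A.
Proof.
move=> cQ cA QA PQ step.
suff main k (B : {set V}) :
    #|A :\: B| = k -> con B -> Q \subset B -> B \subset A -> P B -> P A.
  exact: main erefl cQ (subxx _) QA PQ.
elim: k B => [|k IHk] B cardAB cB QB BA PB.
  suff -> : A = B by [].
  apply/eqP; rewrite eqEsubset BA andbT -setD_eq0.
  by rewrite -cards_eq0 cardAB.
have BpA : B \proper A.
  rewrite properE BA -setD_eq0 -cards_eq0 cardAB //.
case/conP: cA => _ /(_ B); case/conP: (cB) => B0 _ /(_ B0 BpA).
case=> y [x [yB xA xB eyx]].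
have xBA : x |: B \subset A by rewrite subUset sub1set xA.
apply: IHk (con_setU1 cB yB eyx) _ xBA _.
- move: cardAB; rewrite (cardsD1 x) inE xB xA add1n => -[<-].
  by apply: eq_card => z; rewrite !inE negb_or andbA.
- exact: subset_trans QB (subsetUr _ _).
- exact: step cB QB BA xA xB yB eyx PB.
Qed.

(** The part of [B] reachable from [x] has no edge leaving it within [B], so it is all of [B]. *)
Lemma con_connect (B : {set V}) (x y : V) :
  con B -> x \in B -> y \in B ->
  connect (fun u v => [&& u \in B, v \in B & e u v]) x y.
Proof.
set r := (X in connect X) => cB xB yB.
pose U := [set z in B | connect r x z].
have [UB|] := eqVneq U B; first by move: yB; rewrite -UB inE => /andP[].
move=> UB; case/conP: cB => _ /(_ U) [].
- by apply/set0Pn; exists x; rewrite inE xB connect0.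
- by rewrite properEneq UB; apply/subsetP=> z; rewrite inE => /andP[].
move=> a [b [aU bB bU eab]].
case/negP: bU; move: aU; rewrite !inE bB => /andP[aB xa].
by apply: connect_trans xa (connect1 _); rewrite /r aB bB.
Qed.

Lemma con_setT : 0 < #|V| -> (forall x y, connect e x y) -> con setT.
Proof.
move=> V0 ce; apply/conP; split; first by rewrite -cards_eq0 cardsT -lt0n.
move=> U /set0Pn[x xU] /properP[_ [y _ yU]].
have [a [b [aU bU eab]]] := connect_cut (ce x y) xU yU.
by exists a, b; split.
Qed.

(** Otherwise a simple path from [a] to [b] inside [B] would close up through [v] to a cycle. *)
Lemma con_unique_nbr (B : {set V}) (v a b : V) :
  acyclic e -> con B -> v \notin B -> a \in B -> b \in B ->
  e v a -> e v b -> a = b.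
Proof.
move=> ace cB vB aB bB eva evb; apply/eqP/negP=> /negP nab.
have /connectP[p0 rp0 lastp0] := con_connect cB aB bB.
case/shortenP: rp0 lastp0 => p rp uniqp _ lastp.
have ep : path e a p by apply: sub_path rp => x y /and3P[].
have pB : all [in B] p.
  by elim: p a rp {aB eva nab uniqp lastp ep} => //= z p IHp a
    /andP[/and3P[_ -> _] /IHp].
have cyc : ucycle e (v :: a :: p).
  apply/andP; split.
    by rewrite /= eva rcons_path ep -lastp e_sym.
  rewrite cons_uniq uniqp andbT inE negb_or.
  rewrite (contraNneq _ vB) => [|->//].
  by apply: contra vB => /(allP pB).
(* As [a] differs from [b], [p] is nonempty and the cycle has at least three vertices. *)
apply: ace cyc => /=.
by case: p lastp nab {rp uniqp ep pB} => [/= ->|//]; rewrite eqxx.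
Qed.

(** * Counting connected sets through a given vertex *)

Definition con_sets (A : {set V}) := [set B : {set V} | con B & B \subset A].

Definition con_sets_at (A : {set V}) (x : V) := [set B in con_sets A | x \in B].

Lemma con_sets_at_mono (A A' : {set V}) (x : V) :
  A \subset A' -> con_sets_at A x \subset con_sets_at A' x.
Proof.
move=> AA'; apply/subsetP=> B; rewrite !inE => /andP[/andP[-> BA] ->].
by rewrite (subset_trans BA AA').
Qed.

Lemma con_sets_at_disjoint (A : {set V}) (x z : V) (F : {set {set V}}) :
  z \notin A -> (forall B, B \in F -> z \in B) ->
  [disjoint con_sets_at A x & F].
Proof.
move=> zA Fz; apply/pred0P=> B /=; apply/negbTE/negP=> /andP[].
rewrite !inE => /andP[/andP[_ /subsetP BA] _] /Fz /BA.
by rewrite (negPf zA).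
Qed.

Lemma card_con_sets_setU1 (A : {set V}) (x : V) : x \notin A ->
  #|con_sets A| + #|con_sets_at (x |: A) x| <= #|con_sets (x |: A)|.
Proof.
move=> xA; apply: leq_card_disjointU.
- apply/subsetP=> B; rewrite !inE => /andP[-> BA].
  exact: subset_trans BA (subsetUr _ _).
- by apply/subsetP=> B; rewrite inE => /andP[].
- apply/pred0P=> B /=; apply/negbTE/negP=> /andP[].
  rewrite !inE => /andP[_ /subsetP BA] /andP[_ /BA].
  by rewrite (negPf xA).
Qed.

(** Used with [M] made of neighbours of a connected [K] disjoint from it: the [2 ^ #|M|] unions are
    then distinct and connected. *)
Definition joins (K M : {set V}) := [set K :|: S | S in powerset M].

Lemma card_joins (K M : {set V}) : [disjoint K & M] ->
  #|joins K M| = 2 ^ #|M|.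
Proof.
move=> KM; rewrite card_in_imset ?card_powerset // => S1 S2.
rewrite !powersetE => S1M S2M eqK.
suff KS (S : {set V}) : S \subset M -> (K :|: S) :\: K = S.
  by rewrite -(KS S1) // eqK KS.
move=> SM; rewrite setDUl setDv set0U; apply/setDidPl.
by rewrite disjoint_sym; apply: disjointWr SM KM.
Qed.

Lemma joins_sub_con_sets_at (K M A : {set V}) (x : V) :
  con K -> x \in K -> K :|: M \subset A ->
  (forall z, z \in M -> exists2 y, y \in K & e y z) ->
  joins K M \subset con_sets_at A x.
Proof.
move=> cK xK; rewrite subUset => /andP[KA MA] nbrM.
apply/subsetP=> _ /imsetP[S + ->]; rewrite powersetE => SM.
rewrite !inE xK subUset KA (subset_trans SM MA) !andbT.
by apply: con_setU_nbrs => // z /(subsetP SM); apply: nbrM.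
Qed.

(** The set [x |: A] itself is new. *)
Lemma card_con_sets_at_setU1 (A : {set V}) (x y l : V) :
  con A -> l \in A -> x \notin A -> y \in A -> e y x ->
  #|con_sets_at A l| < #|con_sets_at (x |: A) l|.
Proof.
move=> cA lA xA yA eyx; rewrite -addn1 -(cards1 (x |: A)).
apply: leq_card_disjointU.
- exact: con_sets_at_mono (subsetUr _ _).
- by rewrite sub1set !inE lA orbT subxx (con_setU1 cA yA eyx).
- apply: (@con_sets_at_disjoint A l x [set x |: A] xA) => B /set1P->.
  exact: setU11.
Qed.

(** Every vertex added on the way from [Q] to [A] brings a new set through [l]. The additive form
    avoids truncated subtraction. *)
Lemma con_sets_at_grow (Q A : {set V}) (l : V) :
  con Q -> con A -> Q \subset A -> l \in Q ->
  #|con_sets_at Q l| + #|A| <= #|con_sets_at A l| + #|Q|.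
Proof.
move=> cQ cA QA lQ.
apply: (con_grow (P := fun B => #|con_sets_at Q l| + #|B|
           <= #|con_sets_at B l| + #|Q|) cQ cA QA) => //.
move=> B x y cB QB _ _ xB yB eyx IH.
have := card_con_sets_at_setU1 cB (subsetP QB l lQ) xB yB eyx.
by rewrite cardsU1 xB; move: IH; clear; lia.
Qed.

Lemma leq_card_con_sets_at (A : {set V}) (l : V) :
  con A -> l \in A -> #|A| <= #|con_sets_at A l|.
Proof.
move=> cA lA; have l1A : [set l] \subset A by rewrite sub1set.
have := con_sets_at_grow (con1 l) cA l1A (set11 l).
suff: 0 < #|con_sets_at [set l] l| by rewrite cards1; clear; lia.
by apply/card_gt0P; exists [set l]; rewrite !inE con1 subxx eqxx.
Qed.

(** Grow [[set l]] towards [A] and stop just before [v] enters: this set is [P], and [u] is the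
    vertex to which [v] is about to be attached. *)
Lemma con_approach (A : {set V}) (l v : V) :
  con A -> l \in A -> v \in A -> l != v ->
  exists P : {set V}, [/\ con P, l \in P, v \notin P, P \subset A
                       & exists2 u, u \in P & e u v].
Proof.
move=> cA lA vA nlv.
have l1A : [set l] \subset A by rewrite sub1set.
apply: (con_grow (P := fun B => v \in B -> exists P : {set V},
  [/\ con P, l \in P, v \notin P, P \subset A & exists2 u, u \in P & e u v])
  (con1 l) cA l1A) vA => [/set1P vl|]; first by rewrite vl eqxx in nlv.
move=> B x y cB lB BA xA xB yB eyx IH /setU1P[vx|]; last exact: IH.
subst x; exists B; split=> //; first by rewrite -sub1set.
by exists y.
Qed.

(** * Lower bounds around a hub with [D.+1] chosen neighbours *)

Section Hub.

Hypothesis ace : acyclic e.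
Hypothesis eirr : irreflexive e.
Variables (v : V) (N : {set V}) (D : nat).
Hypothesis Nv : forall z, z \in N -> e v z.
Hypothesis cardN : #|N| = D.+1.

Lemma hub_notin : v \notin N.
Proof. by apply/negP=> /Nv; rewrite eirr. Qed.

Lemma leq_card_con_sets_at_hub (A : {set V}) (l : V) :
  con A -> v |: N \subset A -> l \in A -> l != v ->
  #|A| + 2 ^ D <= #|con_sets_at A l| + D.+1.
Proof.
move=> cA vNA lA nlv.
have vA : v \in A by apply: (subsetP vNA); rewrite setU11.
have [P [cP lP vP PA [u uP euv]]] := con_approach cA lA vA nlv.
(* [K] adds the hub to [P]; the chosen neighbours left in [M] can be added to [K] freely. *)
pose M := N :\: P; pose K := v |: P.
have cK : con K := con_setU1 cP uP euv.
have lK : l \in K by rewrite inE lP orbT.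
have vK : v \in K by rewrite setU11.
have nbrM z : z \in M -> exists2 y, y \in K & e y z.
  by case/setDP=> /Nv; exists v.
have cKM : con (K :|: M) := con_setU_nbrs cK nbrM.
have KMA : K :|: M \subset A.
  rewrite !subUset sub1set vA PA /=; apply: subset_trans vNA.
  exact: subset_trans (subsetDl _ _) (subsetUr _ _).
have dKM : [disjoint K & M].
  apply/pred0P=> z /=; apply/negbTE/negP=> /andP[/setU1P[->|zP]].
    by rewrite inE (negPf hub_notin) andbF.
  by rewrite inE zP.
have card_KM : #|K :|: M| = #|P|.+1 + #|M|.
  by rewrite cardsU disjoint_setI0 // cards0 subn0 cardsU1 vP.
(* By acyclicity [P] contains at most one neighbour of [v]. *)
have cardM : D <= #|M|.
  rewrite -ltnS -cardN -(cardsID P N) -/M -addn1 addnC leq_add2l.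
  apply/card_le1_eqP => a b /setIP[/Nv eva aP] /setIP[/Nv evb bP].
  exact: con_unique_nbr ace cP vP bP aP evb eva.
have cardM' : #|M| <= D.+1 by rewrite -cardN subset_leq_card // subsetDl.
have := con_sets_at_grow cKM cA KMA (subsetP (subsetUl _ _) _ lK).
(* Sets inside [P] avoid [v], while all joins contain it. *)
have : #|con_sets_at P l| + #|joins K M| <= #|con_sets_at (K :|: M) l|.
  apply: leq_card_disjointU.
  - apply: con_sets_at_mono; apply: subset_trans (subsetUl _ _).
    exact: subsetUr.
  - exact: joins_sub_con_sets_at.
  - apply: (@con_sets_at_disjoint P l v (joins K M) vP) => _ /imsetP[S _ ->].
    by rewrite inE vK.
have := leq_card_con_sets_at cP lP.
rewrite card_joins // card_KM.
move: cardM cardM'; rewrite leq_eqVlt => /orP[/eqP<- _|DM MD].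
  by clear; lia.
(* Here [P] misses [N]: the number of joins doubles, which pays for the one extra vertex of
   [K :|: M]. *)
have -> : #|M| = D.+1 by apply/eqP; rewrite eqn_leq MD.
by rewrite expnS; have := expn_gt0 2 D; clear; lia.
Qed.

Lemma con_star : con (v |: N).
Proof.
by apply: con_setU_nbrs (con1 v) _ => z /Nv evz; exists v; rewrite ?set11.
Qed.

Lemma card_star : #|v |: N| = 2 + D.
Proof. by rewrite cardsU1 hub_notin cardN. Qed.

(** An edge [a b] would be a connected set avoiding [v] with two neighbours of [v]. *)
Lemma hub_nbrs_nonadjacent (a b : V) : a \in N -> b \in N -> e a b = false.
Proof.
move=> aN bN; apply/negP=> eab.
have cab : con (b |: [set a]).
  by apply: (con_setU1 (y := a)) (con1 a) _ _; rewrite ?set11.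
have vab : v \notin b |: [set a].
  rewrite !inE negb_or; apply/andP; split.
    by apply: contraNneq hub_notin => ->.
  by apply: contraNneq hub_notin => ->.
have ab : a = b.
  by apply: con_unique_nbr ace cab vab _ _ (Nv aN) (Nv bN);
    rewrite !inE eqxx ?orbT.
by rewrite ab eirr in eab.
Qed.

(** The hub with any subset of [N] gives [2 ^ D.+1] sets, the singletons of [N] another [D.+1]. The
    star is the broom whose handle is the hub and one neighbour, hence the [2]. *)
Lemma leq_card_con_sets_star : broom_count D 2 <= #|con_sets (v |: N)|.
Proof.
have : #|joins [set v] N| + #|[set [set z] | z in N]| <= #|con_sets (v |: N)|.
  apply: leq_card_disjointU.
  - have nbrN z : z \in N -> exists2 y, y \in [set v] & e y z.
      by move=> /Nv evz; exists v; rewrite ?set11.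
    have := joins_sub_con_sets_at (con1 v) (set11 v) (subxx _) nbrN.
    move/subset_trans; apply.
    by apply/subsetP=> B; rewrite inE => /andP[].
  - apply/subsetP=> _ /imsetP[z zN ->].
    by rewrite inE con1 sub1set inE zN orbT.
  - apply/pred0P=> B /=; apply/negbTE/negP=> /andP[/imsetP[S _ ->]].
    case/imsetP=> z zN /setP/(_ v); rewrite !inE eqxx /= => /esym/eqP vz.
    by move: hub_notin; rewrite vz zN.
rewrite card_joins; last by rewrite disjoints1 hub_notin.
rewrite card_imset; last exact: set1_inj.
by apply: leq_trans; rewrite cardN /broom_count expnS binn; clear; lia.
Qed.

(** Here [m] is the handle length of a broom with as many vertices as [A], and the bound is the
    increment of [broom_count] from [m] to [m.+1]. *)
Lemma leq_card_con_sets_step (A : {set V}) (x y : V) (m : nat) :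
  con A -> v |: N \subset A -> x \notin A -> y \in A -> e y x ->
  #|A| = m + D ->
  m + 2 ^ D <= #|con_sets_at (x |: A) x|.
Proof.
move=> cA vNA xA yA eyx cardA.
have nxv : x != v.
  by apply: contraNneq xA => ->; apply: (subsetP vNA); rewrite setU11.
have := leq_card_con_sets_at_hub (con_setU1 cA yA eyx)
  (subset_trans vNA (subsetUr _ _)) (setU11 x A) nxv.
by rewrite cardsU1 xA cardA; clear; lia.
Qed.

(** A vertex attached to the hub gives itself alone and [2 ^ D.+1] sets made of [x], [v] and part of
    [N]. *)
Lemma con_sets_at_star_gt (x : V) : 0 < D -> x \notin v |: N -> e v x ->
  2 + 2 ^ D < #|con_sets_at (x |: (v |: N)) x|.
Proof.
move=> D0 xvN evx.
have nvx : v != x by move: xvN; rewrite !inE negb_or eq_sym => /andP[].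
have xN : x \notin N by move: xvN; rewrite !inE negb_or => /andP[].
have cxv : con (x |: [set v]).
  by apply: (con_setU1 (y := v)) (con1 v) _ _; rewrite ?set11.
have : #|[set [set x]]| + #|joins (x |: [set v]) N| <=
       #|con_sets_at (x |: (v |: N)) x|.
  apply: leq_card_disjointU.
  - by rewrite sub1set !inE con1 sub1set !inE eqxx.
  - apply: joins_sub_con_sets_at; rewrite ?setU11 ?setUA //.
    by move=> z /Nv evz; exists v; rewrite // !inE eqxx orbT.
  - apply/pred0P=> B /=; apply/negbTE/negP=> /andP[/set1P-> /imsetP[S _]].
    by move/setP/(_ v); rewrite !inE eqxx orbT (negPf nvx).
rewrite cards1 card_joins ?cardN; last first.
  apply/pred0P=> z /=; apply/negbTE/negP=> /andP[].
  by rewrite !inE => /orP[]/eqP->; apply/negP => //; apply: hub_notin.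
apply: leq_trans; rewrite expnS.
have : 2 ^ 1 <= 2 ^ D by rewrite leq_exp2l.
clear; lia.
Qed.

(** * Brooms inside the graph and strict increments *)

(* [s] lists the handle from its far end to the hub [v], as [broom] does. *)
Definition broom_on (s : seq V) (L : {set V}) :=
  [/\ uniq s, last v s = v, #|L| = D,
      forall i j, i < size s -> j < size s ->
        e (nth v s i) (nth v s j) = (i.+1 == j) || (j.+1 == i)
    & forall a, a \in L ->
        [/\ a \notin s, forall b, b \in s -> e a b = (b == v)
          & forall b, b \in L -> e a b = false]].

Lemma broom_on_star (w : V) : w \in N -> broom_on [:: w; v] (N :\ w).
Proof.
move=> wN; have nwv : w != v by apply: contraNneq hub_notin => <-.
split=> //=.
- by rewrite inE nwv.
- by have := cardsD1 w N; rewrite cardN wN add1n => -[].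
- case=> [|[|i]] [|[|j]] //= _ _; rewrite ?eirr //; last exact: Nv.
  by rewrite e_sym Nv.
- move=> a /setD1P[naw aN]; split.
  + by rewrite !inE (negPf naw); apply: contraNneq hub_notin => <-.
  + move=> b; rewrite !inE => /orP[]/eqP->.
      by rewrite hub_nbrs_nonadjacent // (negPf nwv).
    by rewrite e_sym Nv // eqxx.
  + by move=> b /setD1P[_ bN]; rewrite hub_nbrs_nonadjacent.
Qed.

Lemma con_broom_on (t : V) (s : seq V) (L : {set V}) :
  broom_on (t :: s) L -> con [set z in t :: s] /\
  forall z, z \in L -> exists2 y, y \in [set z in t :: s] & e y z.
Proof.
case=> _ lasts _ es eL; split; last first.
  have vs : v \in t :: s by rewrite -lasts /= mem_last.
  move=> z zL; exists v; first by rewrite inE.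
  by have [_ /(_ v vs) + _] := eL z zL; rewrite e_sym eqxx.
apply: con_path; apply/(pathP v) => i lti.
by have := es i i.+1 (ltnW lti) lti; rewrite eqxx /= => ->.
Qed.

(** By acyclicity [t] is the only neighbour of [x] in the old broom, which settles every new
    adjacency. *)
Lemma broom_on_cons (t x : V) (s : seq V) (L : {set V}) :
  broom_on (t :: s) L -> x \notin t :: s -> x \notin L -> e t x ->
  broom_on (x :: t :: s) L.
Proof.
move=> bL xs xL etx; have [cs nbrL] := con_broom_on bL.
have cA := con_setU_nbrs cs nbrL.
set A := _ :|: L in cA.
have xA : x \notin A by rewrite !inE negb_or; move: xs xL; rewrite inE => -> ->.
have tA : t \in A by rewrite !inE eqxx.
have xt z : z \in A -> e x z = (z == t).
  move=> zA; apply/idP/eqP=> [exz|->]; last by rewrite e_sym.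
  by apply: con_unique_nbr ace cA xA zA tA exz _; rewrite e_sym.
have [us lasts cardL es eL] := bL.
have sA z : z \in t :: s -> z \in A by move=> zs; rewrite !inE -in_cons zs.
have LA z : z \in L -> z \in A by move=> zL; rewrite !inE zL orbT.
have nt i : i < size (t :: s) -> (nth v (t :: s) i == t) = (i == 0).
  by move=> lti; rewrite -{2}[t]/(nth v (t :: s) 0) nth_uniq.
split=> //.
- by rewrite cons_uniq xs.
- case=> [|i] [|j] //= lti ltj; last exact: es.
  + by rewrite xt ?nt ?sA ?mem_nth // orbF eq_sym.
  + by rewrite e_sym xt ?nt ?sA ?mem_nth // eq_sym.
- move=> a aL; have [as_ eas eaL] := eL a aL; split=> //.
  + by rewrite inE negb_or as_ andbT; apply: contraNneq xL => <-.
  + move=> b; rewrite inE => /orP[/eqP->|]; last exact: eas.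
    rewrite e_sym xt ?LA //.
    have -> : (x == v) = false.
      apply/negbTE; apply: contraNneq xs => ->.
      by rewrite -{1}lasts /= mem_last.
    by apply: contraNF as_ => /eqP->; rewrite mem_head.
Qed.

Lemma broom_on_behead (t u : V) (s : seq V) (L : {set V}) :
  broom_on (t :: u :: s) L -> broom_on (u :: s) L.
Proof.
case=> /= /andP[_ us] lasts cardL es eL; split=> //.
- move=> i j lti ltj; exact: (es i.+1 j.+1).
- move=> a /eL[]; rewrite inE negb_or => /andP[_ as_] eas eaL; split=> // b bs.
  by apply: eas; rewrite inE bs orbT.
Qed.

(** As [t] lies outside the star and [x] hangs elsewhere, the general increment bound applies to the
    broom without [t]; it loses one, and two sets through [t] more than make up for it. *)
Lemma con_sets_at_off_tail (t x y : V) (s : seq V) (L : {set V}) (m : nat) :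
  let A := [set z in t :: s] :|: L in
  1 < D -> broom_on (t :: s) L -> v |: N \subset [set z in s] :|: L ->
  x \notin A -> y \in A -> y != t -> e y x -> #|A| = m + D ->
  m + 2 ^ D < #|con_sets_at (x |: A) x|.
Proof.
move=> A D1 bL vNA' xA yA nyt eyx cardA.
have [uts lasts cardL _ eL] := bL.
pose A' := [set z in s] :|: L.
have vs : v \in s.
  have := subsetP vNA' v (setU11 _ _); rewrite !inE => /orP[//|/eL[]].
  by rewrite -{1}lasts /= mem_last.
have tA' : t \notin A'.
  rewrite !inE negb_or; case/andP: (uts) => -> _ /=.
  by apply/negP=> /eL[]; rewrite mem_head.
have eqA : A = t |: A' by rewrite /A /A' set_cons setUA.
have cA' : con A'.
  case: s vs bL @A' {uts lasts eL vNA' tA' eqA A xA yA cardA} => // u s _ bL.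
  by have [cs nbrL] := con_broom_on (broom_on_behead bL); apply: con_setU_nbrs.
have yA' : y \in A' by move: yA; rewrite eqA in_setU1 (negPf nyt).
have xA' : x \notin A'.
  by apply: contra xA; rewrite eqA => xA'; rewrite in_setU1 xA' orbT.
have nxt : x != t by apply: contraNneq xA => ->; rewrite eqA setU11.
have [cs nbrL] := con_broom_on bL.
(* Besides the subtrees avoiding [t], the whole set and the whole set without
   a leaf [z] both contain [t] and [x]. *)
have [z zLy] : exists z, z \in L :\ y.
  apply/card_gt0P; move: D1; rewrite -cardL (cardsD1 y L).
  by case: (y \in L) => //; rewrite add0n => /ltnW.
have [nzy zL] := setD1P zLy.
pose B := [set z in t :: s] :|: (L :\ z).
have zB : z \notin B.
  by have [zs _ _] := eL z zL; rewrite in_setU in_set (negPf zs) in_setD1 eqxx.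
(* Taking [z] different from [y] keeps [y] in [B], so [x] can still be attached. *)
have yB : y \in B.
  by move: yA; rewrite !inE (eq_sym y z) nzy.
have cB : con B.
  by apply: con_setU_nbrs cs _ => w /setD1P[_]; apply: nbrL.
have BA : B \subset A by apply: setUS; apply: subsetDl.
have zA : z \in A by rewrite !inE zL orbT.
have cA : con A := con_setU_nbrs cs nbrL.
have zx : z != x by apply: contraNneq xA => <-.
have tB : t \in B by rewrite !inE eqxx.
have cardA' : #|A'| = m.-1 + D.
  have := subset_leq_card vNA'; rewrite card_star -/A'.
  move: cardA; rewrite eqA cardsU1 tA'; clear; lia.
have m1 : m = m.-1.+1.
  by move: cardA; rewrite eqA cardsU1 tA' cardA'; clear; lia.
have := leq_card_con_sets_step cA' vNA' xA' yA' eyx cardA'.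
have : #|con_sets_at (x |: A') x| + #|[set x |: A; x |: B]| <=
       #|con_sets_at (x |: A) x|.
  apply: leq_card_disjointU.
  - by apply: con_sets_at_mono; rewrite eqA setUS // subsetUr.
  - apply/subsetP=> C /set2P[]->; rewrite !inE eqxx /= andbT.
      by rewrite subxx andbT; apply: con_setU1 eyx.
    by rewrite setUS // andbT; apply: con_setU1 eyx.
  - apply: (@con_sets_at_disjoint _ _ t).
      by rewrite inE negb_or tA' inE eq_sym nxt.
    by move=> C /set2P[]->; rewrite inE ?tB ?orbT // eqA setU11 orbT.
rewrite cards2; have -> : x |: A != x |: B.
  apply/negP=> /eqP/setP/(_ z).
  by rewrite !in_setU1 (negPf zx) zA (negPf zB).
by rewrite m1 /=; clear; lia.
Qed.

(** The star is kept apart because any vertex of [N] may still become its handle end. In the other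
    case the inclusion says that the handle end [t] lies outside the star. *)
Definition broom_shape (A : {set V}) :=
  A = v |: N \/ exists t s L, [/\ broom_on (t :: s) L,
    A = [set z in t :: s] :|: L & v |: N \subset [set z in s] :|: L].

(** Every increment is at least that of the broom, so strictness gained once persists; until then
    the shape records where the next vertex must be attached. *)
Lemma broom_dichotomy (A : {set V}) (m : nat) :
  1 < D -> con A -> v |: N \subset A -> #|A| = m + D ->
  broom_count D m < #|con_sets A| \/
  broom_count D m <= #|con_sets A| /\ broom_shape A.
Proof.
move=> D1 cA vNA; move: m.
apply: (con_grow (P := fun A => forall m, #|A| = m + D ->
  broom_count D m < #|con_sets A| \/
  broom_count D m <= #|con_sets A| /\ broom_shape A) con_star cA vNA) => /= [m|].
  rewrite card_star => /addIn<-; right.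
  by split; [exact: leq_card_con_sets_star | left].
move=> B x y cB vNB _ _ xB yB eyx IH m0.
rewrite cardsU1 xB => cardB; pose m := m0.-1.
have := subset_leq_card vNB; rewrite card_star => DB.
have m0E : m0 = m.+1 by rewrite /m; move: cardB DB; clear; lia.
have {}cardB : #|B| = m + D by move: cardB; rewrite m0E; clear; lia.
rewrite m0E broom_countS => {m0E}.
have le1 := card_con_sets_setU1 xB.
have le2 := leq_card_con_sets_step cB vNB xB yB eyx cardB.
have [lt|[le shB]] := IH m cardB.
  by left; apply: leq_trans le1; rewrite -addSn; apply: leq_add.
have strict : m + 2 ^ D < #|con_sets_at (x |: B) x| ->
    broom_count D m + (m + 2 ^ D) < #|con_sets (x |: B)|.
  by move=> lt; apply: leq_trans le1; rewrite -addnS; apply: leq_add.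
have large : broom_count D m + (m + 2 ^ D) <= #|con_sets (x |: B)|.
  exact: leq_trans (leq_add le le2) le1.
case: shB => [eqB|[t [s [L [bL eqB vNs]]]]].
  have [yv|nyv] := eqVneq y v.
    left; apply: strict.
    have -> : m = 2 by move: cardB; rewrite eqB card_star => /addIn.
    by rewrite eqB con_sets_at_star_gt -?eqB // -?yv // ltnW.
  (* The first vertex beyond the star hangs on some [y] of [N], which fixes the handle; the rest of
     [N] are the leaves. *)
  have yN : y \in N by move: yB; rewrite eqB !inE (negPf nyv).
  have eqvN : v |: N = [set z in [:: y; v]] :|: N :\ y.
    apply/setP=> z; rewrite !inE; have [->|_] := eqVneq z y; last by [].
    by rewrite yN orbT.
  right; split=> //; right; exists x, [:: y; v], (N :\ y).
  have xvN : x \notin v |: N by rewrite -eqB.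
  split.
  - apply: broom_on_cons eyx; first exact: broom_on_star.
      by apply: contra xvN => xs; rewrite eqvN in_setU in_set xs.
    by apply: contra xvN => /setD1P[_ xN]; rewrite !inE xN orbT.
  - by rewrite set_cons -setUA -eqvN -eqB.
  - by rewrite eqvN.
have [yt|nyt] := eqVneq y t; last first.
  left; apply: strict; rewrite eqB.
  by apply: (con_sets_at_off_tail (y := y)) nyt eyx _; rewrite -?eqB.
right; split=> //; right; exists x, (t :: s), L.
have : x \notin [set z in t :: s] :|: L by rewrite -eqB.
rewrite inE negb_or inE => /andP[xs xL].
split.
- by apply: broom_on_cons bL xs xL _; rewrite -yt.
- by rewrite set_cons -setUA -eqB.
- by apply: subset_trans vNs _; rewrite set_cons -setUA subsetUr.
Qed.

Lemma broom_shape_broom_on (A : {set V}) : broom_shape A ->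
  exists t s L, broom_on (t :: s) L /\ A = [set z in t :: s] :|: L.
Proof.
case=> [->|[t [s [L [bL eqA _]]]]]; last by exists t, s, L.
have /card_gt0P[w wN] : 0 < #|N| by rewrite cardN.
exists w, [:: v], (N :\ w); split; first exact: broom_on_star.
apply/setP=> z; rewrite !inE; have [->|_] := eqVneq z w; last by [].
by rewrite wN orbT.
Qed.

Lemma broom_on_iso (t : V) (s : seq V) (L : {set V}) :
  broom_on (t :: s) L -> setT = [set z in t :: s] :|: L ->
  graph_iso e (broom #|V| D.+1).
Proof.
move=> bL eqT; have [us lasts cardL es eL] := bL.
have sizes : (#|V| - D.+1).+1 = size (t :: s).
  rewrite -cardsT eqT cardsU cardL (_ : _ :&: L = set0).
    by rewrite cardsE (card_uniqP us) cards0 subn0 /=; clear; lia.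
  apply/setP=> z; rewrite in_setI in_set0 inE; apply/negbTE/negP.
  by case/andP=> zs /eL[]; rewrite zs.
have sizeL : D.+1 - 1 = #|L| by rewrite subn1 cardL.
pose g (x : broom_vertex #|V| D.+1) : V :=
  match x with
  | inl i => nth v (t :: s) i
  | inr j => enum_val (cast_ord sizeL j)
  end.
have gs (i : 'I_(#|V| - D.+1).+1) : i < size (t :: s) by rewrite -sizes.
have gL j : enum_val (cast_ord sizeL j) \in L by apply: enum_valP.
have nthv (i : 'I_(#|V| - D.+1).+1) : (nth v (t :: s) i == v) = (i == ord_max).
  rewrite -{2}lasts -nth_last nth_uniq // -?sizes //.
have ginj : injective g.
  move=> [i|j] [i'|j'] /=.
  - by move/eqP; rewrite nth_uniq // => /eqP/val_inj->.
  - move=> eqg; have [] := eL _ (gL j'); rewrite -eqg.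
    by rewrite mem_nth.
  - move=> eqg; have [] := eL _ (gL j); rewrite eqg.
    by rewrite mem_nth.
  - by move/enum_val_inj/cast_ord_inj->.
have eg x y : e (g x) (g y) = broom #|V| D.+1 x y.
  case: x y => [i|j] [i'|j'] /=.
  - exact: es.
  - by rewrite e_sym; have [_ -> //] := eL _ (gL j'); rewrite ?mem_nth.
  - by have [_ -> //] := eL _ (gL j); rewrite ?mem_nth.
  - have [_ _] := eL _ (gL j); exact.
have gbij : bijective g.
  apply: inj_card_bij ginj _.
  rewrite card_sum !card_ord sizes sizeL -cardsT eqT cardsU.
  by rewrite cardsE (card_uniqP us) leq_subr.
have [f gK fK] := gbij.
(* [g] maps the broom to the graph; the isomorphism sought is its inverse. *)
exists f; first by exists g.
by move=> x y; rewrite -eg !fK.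
Qed.

End Hub.

(** * From vertex sets to subgraphs, embeddings, and cuts of subtrees *)

Lemma card_con_sets_le_num_subtrees : #|con_sets setT| <= num_subtrees e.
Proof.
(* A connected set is sent to the subgraph that it induces. *)
pose F (B : {set V}) := (B, [set A in edge_set e | A \subset B]).
have Finj : injective F by move=> B1 B2 [].
rewrite -(card_imset _ Finj); apply: subset_leq_card.
apply/subsetP=> _ /imsetP[B + ->]; rewrite !inE => /andP[cB _].
have [B0 _] := conP _ cB; apply/and3P; split=> //=.
- apply/andP; split=> /=; first by apply/subsetP=> A; rewrite inE => /andP[].
  by apply/forall_inP=> A; rewrite inE => /andP[].
- apply/forall_inP=> x xB; apply/forall_inP=> y yB.
  apply: connect_sub (con_connect cB xB yB) => a b /and3P[aB bB eab].
  apply: connect1; rewrite inE subUset !sub1set aB bB !andbT.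
  by apply/imsetP; exists (a, b); rewrite ?inE.
Qed.

End ConnectedSets.

Lemma connect_homo (V W : finType) (r : rel V) (r' : rel W) (f : V -> W)
    (x y : V) :
  {homo f : a b / r a b >-> r' a b} -> connect r x y -> connect r' (f x) (f y).
Proof.
move=> rf /connectP[p]; elim: p x => [|z p IHp] x /= => [_ -> //|].
case/andP=> rxz rp lastp; apply: connect_trans (connect1 (rf _ _ rxz)) _.
exact: IHp rp lastp.
Qed.

Lemma edge_setP (V : finType) (e : rel V) (x y : V) :
  symmetric e -> reflect (e x y) ([set x; y] \in edge_set e).
Proof.
move=> e_sym; apply: (iffP imsetP) => [[[a b]]|exy]; last first.
  by exists (x, y); rewrite ?inE.
rewrite inE /= => eab eqs.
have := set21 x y; have := set22 x y; have := set21 a b; have := set22 a b.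
rewrite -{1 2}eqs {3 4}eqs => /set2P[]? /set2P[]? /set2P[]? /set2P[]?;
  by subst=> //; rewrite e_sym.
Qed.

(** Images of vertex and edge sets under [f] are again subtrees. For an isomorphism onto the broom
    this gives the converse inequality. *)
Lemma graph_embedding_num_subtrees (V W : finType) (e : rel V) (e' : rel W)
    (f : V -> W) :
  injective f -> (forall x y, e' (f x) (f y) = e x y) ->
  num_subtrees e <= num_subtrees e'.
Proof.
move=> finj fe.
pose F (H : {set V} * {set {set V}}) :=
  (f @: H.1, [set f @: (A : {set V}) | A in H.2]).
have Finj : injective F.
  move=> [B1 E1] [B2 E2] [/(imset_inj finj)-> eqE].
  by rewrite (imset_inj (imset_inj finj) eqE).
rewrite /num_subtrees -(card_imset _ Finj); apply: subset_leq_card.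
apply/subsetP=> _ /imsetP[[B E] + ->]; rewrite !inE.
case/and3P=> /andP[/= /subsetP Ee /forall_inP EB] /= B0.
move=> /forall_inP conB; apply/and3P; split=> /=.
- apply/andP; split=> /=.
    apply/subsetP=> _ /imsetP[A AE ->].
    have /imsetP[[a b] + ->] := Ee A AE; rewrite inE /= => eab.
    apply/imsetP; exists (f a, f b); first by rewrite inE /= fe.
    by rewrite imsetU !imset_set1.
  by apply/forall_inP=> _ /imsetP[A AE ->]; apply/imsetS/EB.
- by case/set0Pn: B0 => x xB; apply/set0Pn; exists (f x); apply: imset_f.
- apply/forall_inP=> _ /imsetP[x xB ->].
  apply/forall_inP=> _ /imsetP[y yB ->].
  have /forall_inP/(_ y yB) := conB x xB; apply: connect_homo => a b abE /=.
  apply/imsetP; exists [set a; b] => //.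
  by rewrite imsetU !imset_set1.
Qed.

(** A path of [H] from [x] to [y] must leave [U], and its crossing edge belongs to [H]. *)
Lemma subtree_cut (V : finType) (e : rel V) (H : {set V} * {set {set V}})
    (U : {set V}) (x y : V) :
  symmetric e -> is_subtree e H -> x \in H.1 -> y \in H.1 ->
  x \in U -> y \notin U ->
  exists a b, [/\ a \in H.1 :&: U, b \in H.1 :\: U, e a b
                & [set a; b] \in H.2].
Proof.
move=> e_sym /and3P[/andP[/subsetP He /forall_inP H21] _ /forall_inP conH].
move=> xH yH xU yU; have /forall_inP/(_ y yH) := conH x xH.
case/connect_cut/(_ xU yU) => a [b [aU bU abH]].
have /subsetP abS := H21 _ abH.
exists a, b; rewrite !inE aU bU !abS ?set21 ?set22 //; split=> //.
exact/edge_setP/He.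
Qed.

(** * Upper bound for the broom *)

Section Broom.

Variables n Delta : nat.
Local Notation m := (n - Delta).+1.
Local Notation D := (Delta - 1).
Local Notation broomV := (broom_vertex n Delta).
Local Notation e := (broom n Delta).
Local Notation tail := (fun i : 'I_m => inl i : broomV).
Local Notation leaf := (fun j : 'I_D => inr j : broomV).

Lemma broom_sym : symmetric e.
Proof. by move=> [i|i] [j|j] //=; rewrite orbC. Qed.

(** Every edge of the broom is a bridge; this is the form in which its acyclicity is used. *)
Lemma broom_edge_cut (a b : broomV) : e a b ->
  exists U : {set broomV}, [/\ a \in U, b \notin U &
    forall c d, c \in U -> d \notin U -> e c d -> c = a /\ d = b].
Proof.
(* It suffices to treat edges directed along the handle towards the hub or from a leaf to the hub;
   complementing the cut reverses an edge. *)
suff main a' b' : e a' b' ->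
    (if a' is inl i then if b' is inl j then i < j else false else true) ->
    exists U : {set broomV}, [/\ a' \in U, b' \notin U &
    forall c d, c \in U -> d \notin U -> e c d -> c = a' /\ d = b'].
  move=> eab.
  have [|] := boolP (if a is inl i then if b is inl j then i < j else false
    else true); first exact: main.
  move=> nab; have eba : e b a by rewrite broom_sym.
  case: (main b a eba) => [|U [bU aU cutU]].
    case: a b eab nab {eba} => [i|i] [j|j] //= eij.
    by rewrite -leqNgt; case/orP: eij => /eqP<-; lia.
  exists (~: U); rewrite !inE aU bU; split=> // c d; rewrite !inE negbK.
  by move=> cU dU ecd; have [] := cutU d c dU cU; rewrite 1?broom_sym.
case: a' b' => [i|i] [j|j] //= eij ltij.
- exists [set x : broomV | if x is inl k then k <= i else false].
  rewrite !inE leqnn -ltnNge ltij; split=> //.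
  move=> [k|k] [l|l]; rewrite !inE //= -?ltnNge => ki il.
    by case/orP: eij => /eqP eij; case/orP=> /eqP ekl; try lia;
      split; congr inl; apply: val_inj => /=; lia.
  by move/eqP=> kE; move: ki; rewrite kE /= => ?; have := ltn_ord j; lia.
- exists [set leaf i]; rewrite !inE; split=> // c d /set1P-> _.
  by case: d => [k|k] //= /eqP->; rewrite (eqP eij).
Qed.

(** An edge of the broom with both ends in [H] is the only one across its cut, and [H] has to cross
    that cut. So a subtree is determined by its vertices. *)
Lemma broom_subtree_edges (H : {set broomV} * {set {set broomV}}) :
  is_subtree e H -> H.2 = [set A in edge_set e | A \subset H.1].
Proof.
move=> stH; have /and3P[/andP[/subsetP He /forall_inP H21] _ _] := stH.
apply/setP=> A; rewrite inE; apply/idP/andP=> [AH|[/imsetP[[a b]]]].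
  by split; [apply: He | apply: H21].
rewrite inE /= => eab ->; rewrite subUset !sub1set => /andP[aH bH].
have [U [aU bU cutU]] := broom_edge_cut eab.
have [c [d [/setIP[_ cU] /setDP[_ dU] ecd]]] :=
  subtree_cut broom_sym stH aH bH aU bU.
by have [-> ->] := cutU c d cU dU ecd.
Qed.

(** If [k] were missing, no edge of [H] could leave the handle vertices before [k]. *)
Lemma broom_subtree_convex (H : {set broomV} * {set {set broomV}})
    (i j k : 'I_m) :
  is_subtree e H -> inl i \in H.1 -> inl j \in H.1 -> i <= k <= j ->
  inl k \in H.1.
Proof.
move=> stH iH jH /andP[ik kj]; apply/negPn/negP=> kH.
pose U := [set x : broomV | if x is inl l then l < k else false].
have iU : inl i \in U.
  by rewrite inE ltn_neqAle ik andbT; apply: contraNneq kH => /val_inj<-.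
have jU : inl j \notin U by rewrite inE -leqNgt.
have [a [b []]] := subtree_cut broom_sym stH iH jH iU jU.
rewrite !inE; case: a b => [a|a] [b|b] /andP[aH ak] /andP[bk bH] //= eab _.
  case/negP: kH; suff -> : k = b by [].
  by apply: val_inj => /=; case/orP: eab => /eqP; lia.
by move/eqP: eab ak => -> /=; have := ltn_ord k; lia.
Qed.

(** Vertex sets of subtrees through the hub: [p.1] is where the handle part starts and [p.2] the
    leaves kept. *)
Definition hub_family : {set {set broomV}} :=
  [set [set x : broomV | match x with inl k => p.1 <= k | inr j => j \in p.2 end]
     | p : 'I_m * {set 'I_D}].

(* A subpath [i..j] avoiding the hub is encoded by the pair {i, j + 1}. *)
Definition tail_family : {set {set broomV}} :=
  [set [set x : broomV | if x is inl k
           then [exists i in A, i <= k] && [exists j in A, k < j] else false]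
     | A : {set 'I_m} & #|A| == 2].

Definition leaf_family : {set {set broomV}} := [set [set leaf j] | j : 'I_D].

(** A subtree avoiding the hub is a single leaf, since a leaf has no other neighbour, or an interval
    of the handle. *)
Lemma broom_subtree_family (H : {set broomV} * {set {set broomV}}) :
  is_subtree e H -> H.1 \in hub_family :|: tail_family :|: leaf_family.
Proof.
move=> stH; have /and3P[_ /set0Pn[x0 x0H] _] := stH.
pose P (i : 'I_m) := tail i \in H.1.
have [hubH|hubH] := boolP (inl ord_max \in H.1).
  rewrite !inE; apply/orP; left; apply/orP; left; apply/imsetP.
  case: (@arg_minnP _ ord_max P (fun i => i) hubH) => i iH imin.
  exists (i, [set j | inr j \in H.1]) => //.
  apply/setP=> -[k|j]; rewrite !inE //=.
  apply/idP/idP=> [kH|ik]; first exact: imin.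
  by apply: broom_subtree_convex stH iH hubH _; rewrite ik -ltnS /=.
have [j jH|noleaf] := pickP (fun j => leaf j \in H.1).
  rewrite !inE; apply/orP; right; apply/imsetP; exists j => //.
  apply/eqP; rewrite eqEsubset sub1set jH andbT; apply/subsetP=> y yH.
  rewrite !inE; apply/negPn/negP=> nyj.
  have [] := subtree_cut (U := [set leaf j]) broom_sym stH jH yH.
  - by rewrite set11.
  - by rewrite inE.
  - move=> a [b [/setIP[_ /set1P->] /setDP[bH _]]].
    by case: b bH => [b|b] //= bH /eqP eb; case/negP: hubH; rewrite -eb.
rewrite !inE; apply/orP; left; apply/orP; right; apply/imsetP.
case: x0 x0H => [i0 i0H|j0]; last by have := noleaf j0; rewrite /= => ->.
case: (@arg_minnP _ i0 P (fun i => i) i0H) => i iH imin.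
case: (@arg_maxnP _ i0 P (fun i => i) i0H) => j jH jmax.
(* The last vertex [j] is not the hub, so [j.+1] is still an index of the handle. *)
have ltj : j.+1 < m.
  rewrite ltn_neqAle ltn_ord andbT; apply: contra hubH => /eqP[jE].
  by have -> : ord_max = j; first by apply: val_inj; rewrite /= jE.
pose j' := Ordinal ltj.
have ij : i <= j by apply: imin.
exists [set i; j'].
  by rewrite inE cards2 -val_eqE /= neq_ltn ltnS ij.
apply/setP=> -[k|k]; rewrite !inE; last exact: noleaf.
apply/idP/andP=> [kH|[/exists_inP[a aA ak] /exists_inP[b bA kb]]].
  split; apply/exists_inP.
    by exists i; [rewrite set21 | apply: imin].
  by exists j'; [rewrite set22 | rewrite ltnS; apply: jmax].
apply: broom_subtree_convex stH iH jH _.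
by move: ak kb; case/set2P: aA => ->; case/set2P: bA => -> /=; lia.
Qed.

(** The three families have at most as many members as the three terms of [broom_count]. This bound
    meets the lower bound for an arbitrary tree. *)
Lemma num_subtrees_broom_le :
  num_subtrees e <= broom_count D m.
Proof.
have inj1 : {in [set H | is_subtree e H] &,
    injective (@fst _ {set {set broomV}})}.
  move=> [B1 E1] [B2 E2]; rewrite !inE => st1 st2 /= eqB.
  have := broom_subtree_edges st1; have := broom_subtree_edges st2.
  by rewrite /= eqB => -> ->.
rewrite /num_subtrees -(card_in_imset inj1).
apply: (@leq_trans #|hub_family :|: tail_family :|: leaf_family|).
  apply/subset_leq_card/subsetP=> _ /imsetP[H + ->].
  by rewrite inE; apply: broom_subtree_family.
apply: leq_trans (leq_card_setU _ _) _; apply: leq_add.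
  apply: leq_trans (leq_card_setU _ _) _; apply: leq_add.
    apply: leq_trans (leq_imset_card _ _) _.
    rewrite card_prod card_ord -cardsT -powersetT card_powerset.
    by rewrite cardsT card_ord.
  apply: leq_trans (leq_imset_card _ _) _.
  by rewrite -[X in 'C(X, 2)]card_ord -card_draws cardsE.
by apply: leq_trans (leq_imset_card _ _) _; rewrite card_ord.
Qed.

End Broom.

(** * Comparison with the broom and the case of equality *)

Theorem theorem3p6 (V : finType) (e : rel V) (n Delta : nat)
    (hDelta : 2 < Delta) (hT : is_tree e) (hn : #|V| = n)
    (hmax : Delta <= max_degree e) :
  num_subtrees (broom n Delta) <= num_subtrees e /\
  (num_subtrees e = num_subtrees (broom n Delta) <->
   graph_iso e (broom n Delta)).
Proof.
have [[e_sym eirr] V0 ce ace] := hT.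
have [v degv] := eq_bigmax (degree e) V0.
have : Delta <= degree e v by rewrite -degv.
(* Exactly [Delta] neighbours of a vertex of maximum degree are kept, even if it has more. *)
case/card_geqP=> s [us sizes sN]; pose N := [set z in s].
have Nv z : z \in N -> e v z by rewrite inE => /sN; rewrite inE.
case: Delta hDelta hmax sizes => // D D1 _ sizes.
have cardN : #|N| = D.+1 by rewrite cardsE (card_uniqP us).
(* The star has [D + 2] vertices, so [n - D.+1] is not truncated. *)
have cardV : #|[set: V]| = (n - D.+1).+1 + D.
  have := subset_leq_card (subsetT (v |: N)).
  by rewrite (card_star eirr Nv cardN) cardsT hn; clear; lia.
have := num_subtrees_broom_le n D.+1; rewrite subn1 /= => le_broom.
have le_con := card_con_sets_le_num_subtrees e.
have cT := con_setT V0 ce.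
have dich := broom_dichotomy e_sym ace eirr Nv cardN D1 cT (subsetT _) cardV.
have le_e : num_subtrees (broom n D.+1) <= num_subtrees e.
  apply: leq_trans le_con; apply: leq_trans le_broom _.
  by case: dich => [/ltnW//|[]].
split=> //; split=> [eq_e|[f /bij_inj finj fe]]; last first.
  by apply/eqP; rewrite eqn_leq le_e (graph_embedding_num_subtrees finj fe).
(* Equality excludes the strict alternative, so the whole vertex set has the shape of a broom. *)
case: dich => [lt|[_ /(broom_shape_broom_on e_sym ace eirr Nv cardN)]].
  by have := leq_trans (leq_ltn_trans le_broom lt) le_con; rewrite eq_e ltnn.
by case=> t [s' [L [bL eqT]]]; rewrite -hn; apply: broom_on_iso bL eqT.
Qed.
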